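(* The Fractal Self-Dual Method (FSDM) exhibits the following rate: for every nonexpansive $T:\mathcal X\to\mathcal X$ with a fixed point $y_\star$ and every $y_0\in\mathcal X$, $$\|y_{2^n-1}-Ty_{2^n-1}\|^2\le\frac{4\|y_0-y_\star\|^2}{2^{2n}}\qquad\text{for } n=1,2,\dots.$$
   Context: $\mathcal X$ is a real Hilbert space; $T:\mathcal X\to\mathcal X$ is nonexpansive if $\|Tx-Ty\|\le\|x-y\|$ for all $x,y\in\mathcal X$; a fixed point is $y_\star$ with $Ty_\star=y_\star$. A lower triangular real matrix $H=(h_{k,j})_{1\le j\le k\le M}$ defines the $M$-step algorithm $y_{k+1}=y_k-\sum_{j=0}^{k}h_{k+1,j+1}(y_j-Ty_j)$, $k=0,\dots,M-1$; $[\,]$ denotes the $0\times0$ matrix. For $H$ of size $N-1$, its H-dual $H^{\mathsf A}$ is the anti-diagonal transpose, $(H^{\mathsf A})_{k,j}=h_{N-j,N-k}$. For $H$ of size $N-1$ and $m,j\in\{1,\dots,N-1\}$, $Q(m,j;H)=\sum\prod_{r=1}^m h_{i(r),j(r)}$, the sum over all integers $j=j(1)\le i(1)<j(2)\le i(2)<\cdots<j(m)\le i(m)\le N-1$. Gluing. For $1\le N'\le N-1$ and $H_1,H_2$ of sizes $N'-1$ and $N-N'-1$, $H_1\bowtie H_2$ is the lower triangular $(N-1)\times(N-1)$ matrix with entries: $h_{k,j}=(H_1)_{k,j}$ for $1\le j\le k\le N'-1$; $h_{k,j}=(H_2)_{k-N',j-N'}$ for $N'+1\le j\le k\le N-1$;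 $h_{k,j}=0$ for $j\le N'-1$, $k\ge N'+1$; $h_{N',j}=-\frac{N-N'}{N}\sum_{k=j}^{N'-1}(H_1)_{k,j}$ for $j\le N'-1$; $h_{N',N'}=\frac{N'(N-N')}{N}$; and $h_{N'+1,N'},\dots,h_{N-1,N'}$ are the unique values with $Q(m,N';H_1\bowtie H_2)=\frac{N'(N-N'+1)}{N(m+1)}\binom{N-N'-1}{m-1}$ for $m=1,\dots,N-N'$. FSDM. Let $H_{\mathrm{FSDM}}(0)=[\,]$ and, for $N=2^n$ with $n\ge1$, $H_{\mathrm{FSDM}}(N-1)=H_{\mathrm{FSDM}}(\tfrac N2-1)\bowtie H_{\mathrm{FSDM}}^{\mathsf A}(\tfrac N2-1)$, where $H^{\mathsf A}_{\mathrm{FSDM}}(\cdot)$ is the H-dual of $H_{\mathrm{FSDM}}(\cdot)$. FSDM is the algorithm whose H-matrix for the first $2^n-1$ iterations is $H_{\mathrm{FSDM}}(2^n-1)$ for all $n\ge1$ (each is the upper left submatrix of the later ones). *)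

(* Defs.v *)
From HB Require Import structures.
From mathcomp Require Import all_boot all_order all_algebra.
From mathcomp Require Import all_classical all_reals all_analysis.

Set Implicit Arguments.
Unset Strict Implicit.
Unset Printing Implicit Defensive.

Import Order.TTheory GRing.Theory Num.Theory.
Import numFieldNormedType.Exports.

Local Open Scope classical_set_scope.
Local Open Scope ring_scope.

(* A lower triangular matrix of size M is represented by its entry function
   H : nat -> nat -> R, with 1-based indices: the entry h_{k,j} is H k j for
   1 <= j <= k <= M, and the values of H outside this range are 0. *)

Definition Hdual (R : realType) (N : nat) (H : nat -> nat -> R) :
  nat -> nat -> R :=
  fun k j => if (1 <= j <= k)%N && (k <= N - 1)%N
             then H (N - j)%N (N - k)%N else 0.

(* The pair c r is (i(r+1), j(r+1)); since 'I_N is {0, ..., N - 1}, the upper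
   bound i(m) <= N - 1 is carried by the type. *)
Definition Qchain (N m j : nat) (c : {ffun 'I_m -> 'I_N * 'I_N}) : bool :=
  [&& [forall r : 'I_m, (r == 0%N :> nat) ==> ((c r).2 == j :> nat)],
      [forall r : 'I_m, ((c r).2 <= (c r).1)%N] &
      [forall r : 'I_m, forall s : 'I_m, (s == r.+1 :> nat) ==> ((c r).1 < (c s).2)%N]].

Definition Q (R : realType) (N m j : nat) (H : nat -> nat -> R) : R :=
  \sum_(c : {ffun 'I_m -> 'I_N * 'I_N} | Qchain j c)
    \prod_(r < m) H (c r).1 (c r).2.

(* The gluing of H1 (size N' - 1) and H2 (size N - N' - 1), in which the
   entries h_{k,N'}, N' + 1 <= k <= N - 1, are left as parameters v k. *)
Definition glue_with (R : realType) (N' N : nat) (H1 H2 : nat -> nat -> R)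
    (v : nat -> R) : nat -> nat -> R :=
  fun k j =>
    if ~~ ((1 <= j <= k)%N && (k <= N - 1)%N) then 0
    else if (k < N')%N then H1 k j
    else if k == N' then
      if j == N' then (N' * (N - N'))%:R / N%:R
      else - ((N - N')%:R / N%:R) * \sum_(j <= i < N') H1 i j
    else
      if (j < N')%N then 0
      else if j == N' then v k
      else H2 (k - N')%N (j - N')%N.

(* The requirement that v vanishes off the range makes v unique as a function
   on nat whenever its entries on the range are. *)
Definition glue_column (R : realType) (N' N : nat) (H1 H2 : nat -> nat -> R)
    (v : nat -> R) : Prop :=
  (forall k, ~~ (N' < k <= N - 1)%N -> v k = 0) /\
  (forall m, (1 <= m <= N - N')%N ->
     Q N m N' (glue_with N' N H1 H2 v) =
     (N' * (N - N' + 1))%:R / (N * (m + 1))%:R * 'C(N - N' - 1, m - 1)%:R).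

(* xget selects the unique solution of glue_column; it returns the default
   value 0 if existence or uniqueness fails. *)
Definition glue (R : realType) (N' N : nat) (H1 H2 : nat -> nat -> R) :
  nat -> nat -> R :=
  glue_with N' N H1 H2
    (xget (fun=> 0) [set v | glue_column N' N H1 H2 v /\
                      forall w, glue_column N' N H1 H2 w -> w = v]).

(* H_FSDM R n has size 2 ^ n - 1; for n = 0 it is the 0 x 0 matrix. *)
Fixpoint H_FSDM (R : realType) (n : nat) : nat -> nat -> R :=
  if n is n'.+1 then
    glue (2 ^ n') (2 ^ n'.+1) (H_FSDM R n') (Hdual (2 ^ n') (H_FSDM R n'))
  else fun _ _ => 0.

Definition step_algorithm (R : realType) (X : normedModType R) (M : nat)
    (H : nat -> nat -> R) (T : X -> X) (y : nat -> X) : Prop :=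
  forall k, (k < M)%N ->
    y k.+1 = y k - \sum_(0 <= j < k.+1) H k.+1 j.+1 *: (y j - T (y j)).

Definition FSDM (R : realType) (X : normedModType R) (T : X -> X)
    (y : nat -> X) : Prop :=
  forall n, (1 <= n)%N -> step_algorithm (2 ^ n - 1) (H_FSDM R n) T y.

Definition nonexpansive (R : realType) (X : normedModType R) (T : X -> X) :
  Prop := forall x z, `|T x - T z| <= `|x - z|.

(* Each FSDM matrix is the upper left submatrix of the next ones, so that the
   requirements collected in FSDM are compatible (lemma FSDM_exists). *)
Lemma H_FSDM_widen (R : realType) (m n k j : nat) :
  (m <= n)%N -> (1 <= j <= k)%N -> (k <= 2 ^ m - 1)%N ->
  H_FSDM R n k j = H_FSDM R m k j.
Proof.
move=> le_mn jk km; have lt_k i : (m <= i)%N -> (k < 2 ^ i)%N.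
  move=> mi; apply: leq_trans (leq_pexp2l (isT : 0 < 2)%N mi).
  by rewrite -(subnK (expn_gt0 2 m : 0 < 2 ^ m)%N) addn1 ltnS.
elim: n le_mn => [|n IH]; first by rewrite leqn0 => /eqP->.
rewrite leq_eqVlt => /orP[/eqP-> //|]; rewrite ltnS => mn.
rewrite -IH //= /glue /glue_with jk lt_k //=.
by rewrite subn1 -ltnS prednK ?expn_gt0 ?lt_k ?(leqW mn).
Qed.

Lemma FSDM_exists (R : realType) (X : normedModType R) (T : X -> X) (y0 : X) :
  exists y : nat -> X, y 0%N = y0 /\ FSDM T y.
Proof.
pose step (z : nat -> X) k :=
  z k - \sum_(0 <= j < k.+1) H_FSDM R k.+1 k.+1 j.+1 *: (z j - T (z j)).
pose Y := fix Y k : nat -> X := if k is k'.+1 then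
  (fun i => if (i <= k')%N then Y k' i else step (Y k') k') else fun=> y0.
have YE k i : (i <= k)%N -> Y k i = Y i i.
  elim: k => [|k IH]; first by rewrite leqn0 => /eqP->.
  rewrite leq_eqVlt => /orP[/eqP-> //|]; rewrite ltnS => ik.
  by rewrite /= ik IH.
exists (fun k => Y k k); split=> // n n1 k kM.
have -> : Y k.+1 k.+1 = step (Y k) k by rewrite /= ltnn.
rewrite /step; congr (_ - _); apply: eq_big_nat => j /andP[_ jk].
rewrite YE //; congr (_ *: _).
have k2 : (k.+1 <= 2 ^ k.+1 - 1)%N.
  by rewrite subn1 -ltnS prednK ?expn_gt0 // ltn_expl.
have [le_nk|/ltnW le_kn] := leqP n k.+1.
  by apply: H_FSDM_widen.
by apply/esym/H_FSDM_widen.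
Qed.

(* Main.v *)
(* Put u_k = y_k - T y_k and K = 2^n. The FSDM matrix H of size K - 1 is
   self-dual, so the next one is H glued with itself, and the column fixed by
   the conditions on Q is minus half the row sums of H. Hence the first K - 1
   steps of the larger algorithm follow H, then
   y_K = (y_0 + y_{K-1}) / 2 - (K / 2) u_{K-1}, and the last K - 1 steps follow H
   again, with u_{K+k} replaced by u_{K+k} - u_{K-1} / 2. This shift does not
   affect the inequalities |u_i - u_j|^2 <= 2 <y_i - y_j, u_i - u_j>, so the
   bound (K - 1) |u_{K-1}|^2 + 2 <y_{K-1} - y_0, u_{K-1}> <= 0 propagates from K
   to 2K: the new bound is twice that of the second half plus half that of the
   first half, plus the inequality for i = 2K - 1, j = K - 1.
   The values of Q are found by running the algorithm on multiples of the
   identity, where the same recursion gives a geometric sum. *)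

Require Import Defs.
From HB Require Import structures.
From mathcomp Require Import all_boot all_order all_algebra.
From mathcomp Require Import all_classical all_reals all_analysis.
From mathcomp Require Import ring lra zify.
Import Order.TTheory GRing.Theory Num.Theory.
Import numFieldNormedType.Exports.
Local Open Scope ring_scope.

(** * Self-gluing, and the algorithm run with a self-glued matrix *)

(** Column [K] is written out explicitly; [glue_selfdual] later shows that it is the column selected
    by the conditions on [Q]. *)
Definition self_glue (R : realType) (K : nat) (H : nat -> nat -> R) :
  nat -> nat -> R :=
  glue_with K (2 * K) H H (fun k =>
    if (K < k < 2 * K)%N then - 2^-1 * \sum_(1 <= j < (k - K).+1) H (k - K)%N j
    else 0).

(** The increments [u] are left free instead of being [y j - T (y j)]: the second half of a glued
    run obeys the recursion only with shifted increments, and the recursion is also run on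
    polynomials. *)
Definition follows (R : pzRingType) (V : lmodType R) (M : nat)
    (H : nat -> nat -> R) (y u : nat -> V) : Prop :=
  forall k, (k < M)%N ->
    y k.+1 = y k - \sum_(0 <= j < k.+1) H k.+1 j.+1 *: u j.

Section SelfGlue.
Variables (R : realType) (K : nat) (H : nat -> nat -> R).
Hypothesis K_gt0 : (0 < K)%N.

Lemma self_glue_top k j : (1 <= j <= k)%N -> (k < K)%N -> self_glue R K H k j = H k j.
Proof.
move=> jk kK; rewrite /self_glue /glue_with jk kK.
by have -> : (k <= 2 * K - 1)%N by lia.
Qed.

Lemma self_glue_row j : (1 <= j < K)%N ->
  self_glue R K H K j = - 2^-1 * \sum_(j <= i < K) H i j.
Proof.
move=> jK; rewrite /self_glue /glue_with ltnn eqxx.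
have -> : (1 <= j <= K)%N && (K <= 2 * K - 1)%N by lia.
have -> : (j == K) = false by lia.
have -> : (2 * K - K)%N = K by lia.
have K0 : K%:R != 0 :> R by rewrite pnatr_eq0; lia.
by rewrite /= natrM; congr (- _ * _); field.
Qed.

Lemma self_glue_mid : self_glue R K H K K = K%:R / 2.
Proof.
rewrite /self_glue /glue_with ltnn eqxx.
have -> : (1 <= K <= K)%N && (K <= 2 * K - 1)%N by lia.
have -> : (2 * K - K)%N = K by lia.
have K0 : K%:R != 0 :> R by rewrite pnatr_eq0; lia.
by rewrite /= !natrM; field.
Qed.

Lemma self_glue_corner k j : (j < K < k)%N -> self_glue R K H k j = 0.
Proof.
move=> jKk; rewrite /self_glue /glue_with.
case: ifP => // _.
have -> : (k < K)%N = false by lia.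
have -> : (k == K) = false by lia.
by have -> : (j < K)%N by lia.
Qed.

Lemma self_glue_col k : (1 <= k < K)%N ->
  self_glue R K H (K + k)%N K = - 2^-1 * \sum_(1 <= j < k.+1) H k j.
Proof.
move=> kK; rewrite /self_glue /glue_with ltnn eqxx.
have -> : (1 <= K <= K + k)%N && (K + k <= 2 * K - 1)%N by lia.
have -> : (K + k < K)%N = false by lia.
have -> : (K + k == K)%N = false by lia.
have -> : (K < K + k < 2 * K)%N by lia.
by have -> : (K + k - K)%N = k by lia.
Qed.

Lemma self_glue_bottom k j : (1 <= j <= k)%N -> (k < K)%N ->
  self_glue R K H (K + k)%N (K + j)%N = H k j.
Proof.
move=> jk kK; rewrite /self_glue /glue_with.
have -> : (1 <= K + j <= K + k)%N && (K + k <= 2 * K - 1)%N by lia.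
have -> : (K + k < K)%N = false by lia.
have -> : (K + k == K)%N = false by lia.
have -> : (K + j < K)%N = false by lia.
have -> : (K + j == K)%N = false by lia.
have -> : (K + k - K)%N = k by lia.
by have -> : (K + j - K)%N = j by lia.
Qed.

Lemma self_glue_out k j : ~~ ((1 <= j <= k)%N && (k <= 2 * K - 1)%N) ->
  self_glue R K H k j = 0.
Proof. by rewrite /self_glue /glue_with => ->. Qed.

Variables (V : lmodType R) (y u : nat -> V).
Hypothesis yu : follows R V (2 * K - 1) (self_glue R K H) y u.

Lemma follows_self_glue_top : follows R V (K - 1) H y u.
Proof.
move=> k kK; rewrite yu; last by lia.
congr (_ - _); apply: eq_big_nat => j jk; rewrite self_glue_top //; lia.
Qed.

(** Telescoping the first [K - 1] steps writes [y 0 - y (K - 1)] as the combination of the [u j]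
    weighted by the column sums of [H]. Row [K] consists of minus half these sums before the
    diagonal, so it adds half of that difference to [y (K - 1)]. *)
Lemma follows_self_glue_mid :
  y K = 2^-1 *: (y 0%N + y (K - 1)%N) - (K%:R / 2) *: u (K - 1)%N.
Proof.
have eqK : K = (K - 1).+1 by lia.
have tele : y 0%N - y (K - 1)%N =
    \sum_(0 <= j < (K - 1)%N) (\sum_(j.+1 <= i < K) H i j.+1) *: u j.
  rewrite -[LHS]opprK opprB -telescope_sumr // -sumrN.
  transitivity (\sum_(0 <= k < K - 1) \sum_(0 <= j < K - 1 | (j <= k)%N)
      H k.+1 j.+1 *: u j).
    apply: eq_big_nat => k kK; rewrite follows_self_glue_top; last by lia.
    rewrite addrAC subrr add0r opprK (@big_nat_widen _ _ _ _ k.+1 (K - 1)) //=; lia.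
  rewrite (exchange_big_dep_nat xpredT) //=.
  apply: eq_big_nat => j jK; rewrite scaler_suml big_add1 -subn1.
  by rewrite [RHS](@big_nat_widenl _ _ _ j 0).
rewrite [in LHS]eqK yu; last by lia.
rewrite -eqK [in \sum_(0 <= i < K) _]eqK big_nat_recr //= -eqK self_glue_mid.
rewrite (@eq_big_nat _ _ _ _ _ _ (fun j => - 2^-1 *:
   ((\sum_(j.+1 <= i < K) H i j.+1) *: u j))); last first.
  by move=> j jK; rewrite self_glue_row ?scalerA //; lia.
rewrite -scaler_sumr -tele opprD scaleNr opprK addrA; congr (_ - _).
have {1}-> : y (K - 1)%N = 2^-1 *: y (K - 1)%N + 2^-1 *: y (K - 1)%N.
  by rewrite -scalerDl -{1 2}div1r -splitr scale1r.
by rewrite scalerBr scalerDr -addrA (addrC _ (_ - _)) addrNK addrC.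
Qed.

(* Row k of the second half sends u_{K-1} in proportion to minus half its row
   sum, which amounts to shifting every later increment by a constant. *)
Lemma follows_self_glue_bottom :
  follows R V (K - 1) H (fun k => y (K + k)%N)
    (fun k => u (K + k)%N - 2^-1 *: u (K - 1)%N).
Proof.
move=> k kK; rewrite addnS yu; last by lia.
congr (_ - _).
(* Since [u j] is weighted by column [j + 1], the index [K - 1] belongs to column [K]; the earlier
   indices meet the zero corner. *)
rewrite (@big_cat_nat _ _ _ (K - 1)) /=; [|lia|lia].
rewrite big_nat big1 ?add0r => [|j jK]; last first.
  by rewrite self_glue_corner ?scale0r //; lia.
rewrite big_ltn; last by lia.
have eqK : (K - 1).+1 = K by lia.
rewrite eqK -addnS self_glue_col; last by lia.
rewrite -{2}[K]add0n big_addn addKn.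
under [in RHS]eq_bigr do rewrite scalerBr.
rewrite sumrB addrC mulNr scaleNr; congr (_ - _).
  apply: eq_big_nat => j jk; rewrite (addnC j) -[(K + j).+1]addnS self_glue_bottom //; lia.
by rewrite big_add1 /= -scaler_suml scalerA mulrC.
Qed.

End SelfGlue.

(* For T = (1 + x) id the algorithm reproduces the Halpern average
   y_{K-1} = (1 + t + ... + t^(K-1)) / K y_0 with t = 1 + x; its coefficients in
   x are the quantities Q summed over all starting columns. *)
Definition averaging (R : realType) (K : nat) (H : nat -> nat -> R) : Prop :=
  forall A : nat -> {poly R},
    follows R {poly R} (K - 1) H A (fun j => - ('X * A j)) ->
    K%:R *: ('X * A (K - 1)%N) = ((1 + 'X) ^+ K - 1) * A 0%N.

(** As the increments are linear in [A], shifting them amounts to replacing [A (K + k)] by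
    [A (K + k) - A (K - 1) / 2], which starts at [t A 0 / 2] with [t = (1 + X)^K]. The two halves
    then add up to [(t - 1) t + (t - 1) = t^2 - 1]. *)
Lemma averaging_self_glue (R : realType) (K : nat) (H : nat -> nat -> R) :
  (0 < K)%N -> averaging R K H -> averaging R (2 * K) (self_glue R K H).
Proof.
move=> K_gt0 avH A fA.
have /avH top := follows_self_glue_top _ _ _ K_gt0 _ _ _ fA.
have mid := follows_self_glue_mid _ _ _ K_gt0 _ _ _ fA.
have bot := follows_self_glue_bottom _ _ _ K_gt0 _ _ _ fA.
have {bot}/avH bot : follows R {poly R} (K - 1) H
    (fun k => A (K + k)%N - 2^-1 *: A (K - 1)%N)
    (fun j => - ('X * (A (K + j)%N - 2^-1 *: A (K - 1)%N))).
  move=> k kK; rewrite bot // addrAC; congr (_ - _).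
  apply: eq_bigr => j _; congr (_ *: _).
  by rewrite scalerN mulrBr opprB scalerAr opprK addrC.
move: top mid bot; rewrite addn0 -!mul_polyC.
have -> : (2 * K - 1 = K + (K - 1))%N by lia.
move: (A 0%N) (A (K - 1)%N) (A K) (A (K + (K - 1))%N) => a0 a1 a2 a3.
have -> : (K%:R / 2)%:P = (K%:R)%:P * (2^-1)%:P :> {poly R} by rewrite polyCM.
rewrite mulnC exprM natrM polyCM.
have : (2%:R)%:P * (2^-1)%:P = 1 :> {poly R}.
  by rewrite -polyCM divff ?pnatr_eq0.
move: (K%:R)%:P (2^-1)%:P (2%:R)%:P ((1 + 'X) ^+ K) => k h two t htwo top mid bot.
have -> : k * two * ('X * a3) = two * (k * ('X * (a3 - h * a1)))
    + two * h * (k * ('X * a1)) by ring.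
rewrite bot mid htwo mul1r mulrN opprK.
have -> : k * h * ('X * a1) = h * (k * ('X * a1)) by ring.
rewrite top.
have -> : two * ((t - 1) * (h * (a0 + a1) + h * ((t - 1) * a0) - h * a1))
    = two * h * ((t - 1) * (t * a0)) by ring.
by rewrite htwo; ring.
Qed.

(** * Propagation of the rate bound under self-gluing *)

(** The inequality assumed on pairs is nonexpansiveness of [y i - u i] in squared form. It involves
    only differences of increments. *)
Definition rate_bound (R : realType) (X : lmodType R) (dot : {dot X for idfun})
    (K : nat) (H : nat -> nat -> R) : Prop :=
  forall y u : nat -> X, follows R X (K - 1) H y u ->
    (forall i j, (i < K)%N -> (j < K)%N ->
      dot (u i - u j) (u i - u j) <= 2 * dot (y i - y j) (u i - u j)) ->
    (K%:R - 1) * dot (u (K - 1)%N) (u (K - 1)%N)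
      + 2 * dot (y (K - 1)%N - y 0%N) (u (K - 1)%N) <= 0.

Lemma dotC (R : realType) (X : lmodType R) (dot : {dot X for idfun}) (x z : X) :
  dot x z = dot z x.
Proof. by rewrite hermC expr0 mul1r. Qed.

Lemma rate_bound_self_glue (R : realType) (X : lmodType R)
    (dot : {dot X for idfun}) (K : nat) (H : nat -> nat -> R) :
  (0 < K)%N -> rate_bound R X dot K H ->
  rate_bound R X dot (2 * K) (self_glue R K H).
Proof.
move=> K_gt0 cH y u fyu mono.
have top := cH _ _ (follows_self_glue_top _ _ _ K_gt0 _ _ _ fyu).
have mid := follows_self_glue_mid _ _ _ K_gt0 _ _ _ fyu.
have bot := cH _ _ (follows_self_glue_bottom _ _ _ K_gt0 _ _ _ fyu).
have link : dot (u (2 * K - 1)%N - u (K - 1)%N) (u (2 * K - 1)%N - u (K - 1)%N)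
    <= 2 * dot (y (2 * K - 1)%N - y (K - 1)%N) (u (2 * K - 1)%N - u (K - 1)%N).
  by apply: mono; lia.
have {}top := top (fun i j iK jK => mono i j ltac:(lia) ltac:(lia)).
have {}bot : (K%:R - 1) * dot (u (2 * K - 1)%N - 2^-1 *: u (K - 1)%N)
      (u (2 * K - 1)%N - 2^-1 *: u (K - 1)%N)
    + 2 * dot (y (2 * K - 1)%N - y K)
      (u (2 * K - 1)%N - 2^-1 *: u (K - 1)%N) <= 0.
  have := bot; rewrite addn0.
  have -> : (2 * K - 1 = K + (K - 1))%N by lia.
  apply=> i j iK jK; rewrite opprB addrA subrK.
  by apply: mono; lia.
move: top link bot; rewrite mid.
move: (y (K - 1)%N) (y 0%N) (y (2 * K - 1)%N) (u (K - 1)%N) (u (2 * K - 1)%N).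
move=> p y0 Y g e; rewrite natrM.
have dZl a x z : dot (a *: x) z = a * dot x z by exact: linearZl_LR.
have dZr a x z : dot x (a *: z) = a * dot x z by exact: linearZr_LR.
have dBl x x' z : dot (x - x') z = dot x z - dot x' z by exact: linearBl.
have dBr x z z' : dot x (z - z') = dot x z - dot x z' by exact: linearBr.
have dDl x x' z : dot (x + x') z = dot x z + dot x' z by exact: linearDl.
rewrite !(dBl, dBr, dDl, dZl, dZr).
rewrite (dotC R X dot e g).
move: (dot p g) (dot p e) (dot y0 g) (dot y0 e) (dot Y g) (dot Y e).
move: (dot g g) (dot g e) (dot e e) => *.
lra.
Qed.

(** * Recursions for the sums over chains *)

(** This is the sum over what can remain of a chain of [Q] once its first row index is [k]: the next
    column is anywhere beyond [k]. *)
Definition Qafter (R : realType) (N m k : nat) (H : nat -> nat -> R) : R :=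
  \sum_(c : {ffun 'I_m -> 'I_N * 'I_N} |
      [&& [forall r : 'I_m, (r == 0%N :> nat) ==> (k < (c r).2)%N],
          [forall r : 'I_m, ((c r).2 <= (c r).1)%N] &
          [forall r : 'I_m, forall s : 'I_m,
             (s == r.+1 :> nat) ==> ((c r).1 < (c s).2)%N]])
    \prod_(r < m) H (c r).1 (c r).2.

Lemma forall_ord_recl (m : nat) (P : pred 'I_m.+1) :
  [forall r, P r] = P ord0 && [forall s, P (lift ord0 s)].
Proof.
apply/forallP/andP => [PT|[P0 /forallP PS] r].
  by split=> //; apply/forallP=> s.
by case: (unliftP ord0 r) => [s|] ->.
Qed.

Lemma Qafter0 (R : realType) (N k : nat) (H : nat -> nat -> R) :
  Qafter R N 0 k H = 1.
Proof.
rewrite /Qafter (big_pred1 (ffun0 (card_ord 0))).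
  by rewrite big_ord0.
move=> c /=; apply/idP/eqP => _; first by apply/ffunP => -[].
by apply/and3P; split; apply/forallP => -[].
Qed.

Lemma Qafter_rec (R : realType) (N m k : nat) (H : nat -> nat -> R) :
  Qafter R N m.+1 k H = \sum_(k.+1 <= j < N) Q N m.+1 j H.
Proof.
rewrite (@big_nat_widenl _ _ _ _ 0) // big_mkord.
rewrite /Qafter (partition_big (fun c : {ffun 'I_m.+1 -> _} => (c ord0).2)
  (fun j : 'I_N => (k < j)%N)); last first.
  by move=> c /and3P[/forallP/(_ ord0)].
apply: eq_bigr => j kj; apply: eq_bigl => c.
rewrite /Qchain andbC andbA; congr (_ && _).
rewrite !forall_ord_recl /= -(inj_eq val_inj) /=.
have -> : [forall s : 'I_m, true] by apply/forallP.
rewrite !andbT; by case: eqP => [->|//]; rewrite kj.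
Qed.

(** The map [h] prepends the pair of row [i] and column [j] to a chain starting beyond [i]; dropping
    the first pair inverts it on chains that start at column [j]. *)
Lemma Q_rec (R : realType) (N m j : nat) (H : nat -> nat -> R) : (j < N)%N ->
  Q N m.+1 j H = \sum_(j <= i < N) H i j * Qafter R N m i H.
Proof.
move=> jN; rewrite (@big_nat_widenl _ _ _ _ 0) // big_mkord.
under [RHS]eq_bigr do rewrite big_distrr /=.
rewrite pair_big_dep /= /Q.
pose h (ic : 'I_N * {ffun 'I_m -> 'I_N * 'I_N}) : {ffun 'I_m.+1 -> 'I_N * 'I_N} :=
  [ffun r => if unlift ord0 r is Some s then ic.2 s else (ic.1, Ordinal jN)].
have h0 ic : h ic ord0 = (ic.1, Ordinal jN) by rewrite ffunE unlift_none.
have hS ic s : h ic (lift ord0 s) = ic.2 s by rewrite ffunE liftK.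
rewrite (reindex h); last first.
  exists (fun c : {ffun 'I_m.+1 -> 'I_N * 'I_N} =>
    ((c ord0).1, [ffun s : 'I_m => c (lift ord0 s)])) => [[i c] _|c].
    by rewrite h0; congr pair; apply/ffunP => s; rewrite ffunE hS.
  rewrite inE => /and3P[/forallP/(_ ord0)/= /eqP cj _ _]; apply/ffunP => r.
  case: (unliftP ord0 r) => [s|] ->; first by rewrite hS ffunE.
  by rewrite h0 [RHS]surjective_pairing; congr pair; apply: val_inj.
apply: eq_big => [[i c]|[i c] _]; last first.
  by rewrite big_ord_recl h0 /=; congr (_ * _); apply: eq_bigr => s _; rewrite hS.
rewrite /Qchain /= !forall_ord_recl h0 /= eqxx /=.
have -> : [forall s : 'I_m, (lift ord0 s == 0%N :> nat) ==>
    ((h (i, c) (lift ord0 s)).2 == j :> nat)] by apply/forallP.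
rewrite /= -!andbA; congr (_ && _).
rewrite andbCA; congr [&& _, _ & _].
- by apply: eq_forallb => s; rewrite hS.
- by apply: eq_forallb => s; rewrite hS.
- apply: eq_forallb => s; rewrite forall_ord_recl /=.
  by apply: eq_forallb => r; rewrite !hS.
Qed.

(** The columns of a chain increase strictly, and fewer than [m] of them lie between [k + 1] and
    [N - 1]. *)
Lemma Qafter_eq0 (R : realType) (N m k : nat) (H : nat -> nat -> R) :
  (0 < m)%N -> (N <= m + k)%N -> Qafter R N m k H = 0.
Proof.
elim: m k => // m IH k _ Nmk; rewrite Qafter_rec big_nat big1 // => j jN.
rewrite Q_rec; last by lia.
by rewrite big_nat big1 // => i iN; rewrite IH ?mulr0 //; lia.
Qed.

(** Exactly [m] columns are available, so the only chain is the diagonal one and the sum is a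
    product of diagonal entries. *)
Lemma Qafter_neq0 (R : realType) (N m k : nat) (H : nat -> nat -> R) :
  (forall i, (0 < i < N)%N -> H i i != 0) -> (m + k).+1 = N ->
  Qafter R N m k H != 0.
Proof.
move=> H0; elim: m k => [|m IH] k mkN; first by rewrite Qafter0 oner_eq0.
rewrite Qafter_rec big_ltn; last by lia.
rewrite [X in _ + X]big_nat big1 ?addr0 => [|j jN]; last first.
  rewrite Q_rec; last by lia.
  rewrite big_nat big1 // => i iN; rewrite Qafter_eq0 ?mulr0 //; lia.
rewrite Q_rec; last by lia.
rewrite big_ltn; last by lia.
rewrite big_nat big1 ?addr0 => [|i iN]; last first.
  by rewrite Qafter_eq0 ?mulr0 //; lia.
by rewrite mulf_neq0 ?H0 ?IH //; lia.
Qed.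

(** A chain starting beyond column [K] stays in the lower block, a shifted copy of [H]. *)
Lemma Qafter_glue (R : realType) (K m k : nat) (H : nat -> nat -> R)
    (v : nat -> R) :
  Qafter R (2 * K) m (K + k) (glue_with K (2 * K) H H v) = Qafter R K m k H.
Proof.
elim: m k => [|m IH] k; first by rewrite !Qafter0.
rewrite !Qafter_rec.
have -> : ((K + k).+1 = k.+1 + K)%N by lia.
rewrite big_addn.
have -> : (2 * K - K = K)%N by lia.
apply: eq_big_nat => j jK; rewrite !Q_rec; [|lia|lia].
rewrite big_addn.
have -> : (2 * K - K = K)%N by lia.
apply: eq_big_nat => i iK; rewrite -IH addnC; congr (_ * _).
rewrite addnC /glue_with.
have -> : (1 <= j + K <= i + K)%N && (i + K <= 2 * K - 1)%N by lia.
have -> : (i + K < K)%N = false by lia.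
have -> : (i + K == K)%N = false by lia.
have -> : (j + K < K)%N = false by lia.
have -> : (j + K == K)%N = false by lia.
by rewrite !addnK.
Qed.

(** Only the first entry of such a chain lies in column [K], so the conditions on [Q] are affine in
    [v]. *)
Lemma Q_glue (R : realType) (K m : nat) (H : nat -> nat -> R) (v : nat -> R) :
  (0 < K)%N ->
  Q (2 * K) m.+1 K (glue_with K (2 * K) H H v) =
    K%:R / 2 * Qafter R K m 0 H +
    \sum_(1 <= i < K) v (K + i)%N * Qafter R K m i H.
Proof.
move=> K_gt0; rewrite Q_rec; last by lia.
rewrite -{1}[K]add0n big_addn.
have -> : (2 * K - K = K)%N by lia.
have := Qafter_glue R K m 0 H v; rewrite addn0 => Q0.
rewrite big_ltn // add0n Q0; congr (_ * _ + _).
  by rewrite -(self_glue_mid R K H K_gt0) /self_glue /glue_with ltnn !eqxx.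
apply: eq_big_nat => i iK; rewrite addnC Qafter_glue; congr (_ * _).
rewrite /glue_with ltnn eqxx.
have -> : (1 <= K <= K + i)%N && (K + i <= 2 * K - 1)%N by lia.
have -> : (K + i < K)%N = false by lia.
by have -> : (K + i == K)%N = false by lia.
Qed.

(** * Gluing a self-dual matrix with itself: values of [Q], uniqueness of the column,
    self-duality *)

Section Glue.
Variables (R : realType) (K : nat) (H : nat -> nat -> R).
Hypotheses (K_gt0 : (0 < K)%N) (selfdual : Hdual K H = H).
Hypotheses (H_diag : forall i, (0 < i < K)%N -> H i i != 0).
Hypothesis H_avg : averaging R K H.

Lemma coef_Qafter_poly k m : (k < K)%N ->
  (\poly_(l < K) Qafter R K l (K - 1 - k) H)`_m = Qafter R K m (K - 1 - k) H.
Proof.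
move=> kK; rewrite coef_poly; case: ltnP => // Km.
by rewrite Qafter_eq0 //; lia.
Qed.

(* Self-duality turns the recursion for chains read from their first column
   into the recursion of the algorithm, run forwards. *)
Lemma follows_Qafter : follows R {poly R} (K - 1) H
  (fun k => \poly_(l < K) Qafter R K l (K - 1 - k) H)
  (fun j => - ('X * \poly_(l < K) Qafter R K l (K - 1 - j) H)).
Proof.
move=> k kK; apply/polyP => m.
rewrite coefB coef_sum !coef_Qafter_poly; [|lia|lia].
under eq_big_nat => j jk do rewrite coefZ coefN coefXM.
case: m => [|m]; first by rewrite !Qafter0 big1 ?subr0 // => j _; rewrite oppr0 mulr0.
under eq_big_nat => j jk do
  [rewrite /= coef_Qafter_poly ?mulrN; last by lia].
rewrite sumrN opprK !Qafter_rec big_ltn; last by lia.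
have -> : (K - 1 - k.+1).+1 = (K - 1 - k)%N by lia.
rewrite addrC; congr (_ + _).
rewrite Q_rec; last by lia.
(* Read backwards, column [K - 1 - k] of [H] is row [k + 1] of its dual. *)
rewrite -{1}[(K - 1 - k)%N]add0n big_addn big_nat_rev /=.
have -> : (K - (K - 1 - k) = k.+1)%N by lia.
apply: eq_big_nat => j jk; rewrite add0n.
have -> : (k.+1 - j.+1 + (K - 1 - k) = K - 1 - j)%N by lia.
congr (_ * _); rewrite -[in RHS]selfdual /Hdual.
have -> : (1 <= j.+1 <= k.+1)%N && (k.+1 <= K - 1)%N by lia.
by congr (H _ _); lia.
Qed.

(** The polynomial run of [follows_Qafter] starts at 1, as no column exceeds [K - 1], and ends at
    the generating polynomial of [Qafter R K m 0 H]. By [H_avg], [K X] times the latter is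
    [(1 + X)^K - 1]. *)
Lemma Qafter_bin m : K%:R * Qafter R K m 0 H = 'C(K, m.+1)%:R.
Proof.
have /(congr1 (fun p : {poly R} => p`_m.+1)) := H_avg _ follows_Qafter.
rewrite coefZ coefXM /= coef_Qafter_poly; last by lia.
rewrite subnn => ->.
have -> : \poly_(l < K) Qafter R K l (K - 1 - 0) H = 1.
  apply/polyP => l; rewrite coef_Qafter_poly // coef1.
  by case: l => [|l]; rewrite ?Qafter0 // Qafter_eq0 //; lia.
rewrite mulr1 coefB coef1 subr0 addrC exprD1n.
under eq_bigr => l _ do rewrite -scaler_nat.
rewrite -(poly_def K.+1 (fun l => 'C(K, l)%:R)) coef_poly ltnS.
by case: leqP => // Km; rewrite bin_small.
Qed.

(** Chains of length [m + 1] are grouped by their first row instead of their first column. This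
    evaluates the contribution of column [K], built from row sums. *)
Lemma Qafter_row_sum m :
  \sum_(1 <= i < K) (\sum_(1 <= j < i.+1) H i j) * Qafter R K m i H =
  Qafter R K m.+1 0 H.
Proof.
rewrite Qafter_rec.
rewrite [RHS](@eq_big_nat _ _ _ _ _ _
  (fun j => \sum_(1 <= i < K | (j <= i)%N) H i j * Qafter R K m i H)); last first.
  by move=> j jK; rewrite Q_rec ?(@big_nat_widenl _ _ _ j 1) //; lia.
rewrite [RHS](exchange_big_dep_nat xpredT) //=.
apply: eq_big_nat => i iK; rewrite big_distrl /=.
by rewrite (@big_nat_widen _ _ _ _ i.+1 K) //; lia.
Qed.

(** For chain length [m + 1] the left side is [C(K, m + 1) / 2 - C(K, m + 2) / (2 K)]; the
    identities [e1] and [e2] express everything through [C(K, m + 1)]. *)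
Lemma Q_self_glue m : (1 <= m <= K)%N ->
  Q (2 * K) m K (self_glue R K H) =
  (K * (K + 1))%:R / (2 * K * (m + 1))%:R * 'C(K - 1, m - 1)%:R.
Proof.
case: m => // m mK; rewrite Q_glue //.
have -> : \sum_(1 <= i < K) (if (K < K + i < 2 * K)%N then
      - 2^-1 * \sum_(1 <= j < (K + i - K).+1) H (K + i - K)%N j else 0)
      * Qafter R K m i H = - 2^-1 * Qafter R K m.+1 0 H.
  rewrite -Qafter_row_sum big_distrr /=; apply: eq_big_nat => i iK.
  have -> : (K < K + i < 2 * K)%N by lia.
  by rewrite addKn mulrA.
have K0 : K%:R != 0 :> R by rewrite pnatr_eq0; lia.
have e1 := mul_bin_diag K m.
have e2 := mul_bin_left K m.+1.
have p1 := Qafter_bin m; have p2 := Qafter_bin m.+1.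
have -> : Qafter R K m 0 H = 'C(K, m.+1)%:R / K%:R.
  by rewrite -p1 mulrC mulKf.
have -> : Qafter R K m.+1 0 H = 'C(K, m.+2)%:R / K%:R.
  by rewrite -p2 mulrC mulKf.
have m1 : (m.+1)%:R != 0 :> R by rewrite pnatr_eq0.
have m2 : (m.+2)%:R != 0 :> R by rewrite pnatr_eq0.
have {}e1 : 'C(K - 1, m)%:R = (m.+1)%:R * 'C(K, m.+1)%:R / K%:R :> R.
  by rewrite subn1 -natrM -e1 natrM mulrC mulKf.
have {}e2 : 'C(K, m.+2)%:R = (K%:R - (m.+1)%:R) * 'C(K, m.+1)%:R / (m.+2)%:R :> R.
  by rewrite -natrB; [rewrite -natrM -e2 natrM mulrC mulKf|lia].
rewrite subSS subn0 e1 e2 !natrM !addn1.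
have -> : (K.+1)%:R = K%:R + 1 :> R by rewrite -natr1.
move: m1 m2; have -> : (m.+2)%:R = (m.+1)%:R + 1 :> R by rewrite -natr1.
move: (m.+1)%:R 'C(K, m.+1)%:R K%:R K0 => x c k k0 x0 x1.
by field; rewrite k0 x1.
Qed.

(** The system is triangular: chain length [K - k] involves only the unknowns up to [v (K + k)], the
    last one with a nonzero coefficient by [Qafter_neq0]. *)
Lemma glue_column_inj v w : glue_column K (2 * K) H H v ->
  glue_column K (2 * K) H H w -> v = w.
Proof.
move=> [v0 vQ] [w0 wQ]; apply/funext => k.
have [Kk|Kk] := boolP (K < k <= 2 * K - 1)%N; last by rewrite v0 ?w0.
have -> : (k = K + (k - K))%N by lia.
have : (0 < k - K < K)%N by lia.
move: (k - K)%N => {Kk}{}k; elim/ltn_ind: k => k IH kK.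
have : Q (2 * K) (K - 1 - k).+1 K (glue_with K (2 * K) H H v) =
       Q (2 * K) (K - 1 - k).+1 K (glue_with K (2 * K) H H w).
  by rewrite vQ ?wQ //; lia.
rewrite !Q_glue // => /addrI.
have split_sum (f : nat -> R) :
    \sum_(1 <= i < K) f (K + i)%N * Qafter R K (K - 1 - k) i H =
    \sum_(1 <= i < k) f (K + i)%N * Qafter R K (K - 1 - k) i H +
    f (K + k)%N * Qafter R K (K - 1 - k) k H.
  rewrite (@big_cat_nat _ _ _ k) /=; [|lia|lia].
  congr (_ + _); rewrite big_ltn; last by lia.
  rewrite [X in _ + X]big_nat big1 ?addr0 // => i ik.
  by rewrite Qafter_eq0 ?mulr0 //; lia.
rewrite !split_sum.
have -> : \sum_(1 <= i < k) v (K + i)%N * Qafter R K (K - 1 - k) i H =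
          \sum_(1 <= i < k) w (K + i)%N * Qafter R K (K - 1 - k) i H.
  by apply: eq_big_nat => i ik; rewrite IH //; lia.
move=> /addrI /mulIf; apply; apply: Qafter_neq0 => //; lia.
Qed.

Lemma glue_selfdual : Defs.glue K (2 * K) H H = self_glue R K H.
Proof.
rewrite /Defs.glue /self_glue.
set v := (X in _ = glue_with _ _ _ _ X); congr glue_with.
have cv : glue_column K (2 * K) H H v.
  split=> [k|m mK]; first by rewrite /v; case: ifP => //; lia.
  have e : (2 * K - K = K)%N by lia.
  by move: mK; rewrite e => mK; rewrite -Q_self_glue.
(* The explicit column is the unique solution, so [xget] does not fall back on its default. *)
apply: xget_unique; first by split=> // w cw; apply: glue_column_inj.
by move=> w [cw _]; apply: glue_column_inj.
Qed.

(** Anti-diagonal transposition exchanges the two copies of [H] and exchanges row [K] with column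
    [K]; self-duality turns column sums of [H] into row sums. *)
Lemma Hdual_self_glue : Hdual (2 * K) (self_glue R K H) = self_glue R K H.
Proof.
have dualE k j : (1 <= j <= k)%N -> (k < K)%N -> H (K - j)%N (K - k)%N = H k j.
  move=> jk kK; rewrite -[in RHS]selfdual /Hdual.
  by have -> : (1 <= j <= k)%N && (k <= K - 1)%N by lia.
have row_col k : (1 <= k < K)%N ->
    \sum_(K - k <= i < K) H i (K - k)%N = \sum_(1 <= j < k.+1) H k j.
  move=> kK; rewrite -{1}[(K - k)%N]add0n big_addn big_add1 /= subKn; last by lia.
  rewrite big_nat_rev; apply: eq_big_nat => j jk.
  by rewrite -[RHS]dualE; [congr (H _ _); lia|lia|lia].
apply/funext => k; apply/funext => j; rewrite /Hdual.
case: ifPn => [jk|jk]; last by rewrite self_glue_out.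
have [kK|Kk|kK] := ltngtP k K.
- have -> : (2 * K - j = K + (K - j))%N by lia.
  have -> : (2 * K - k = K + (K - k))%N by lia.
  rewrite self_glue_bottom ?self_glue_top ?dualE //; lia.
- have [jK|Kj|->] := ltngtP j K.
  + by rewrite !self_glue_corner //; lia.
  + rewrite self_glue_top //; [|lia|lia].
    have -> : (k = K + (k - K))%N by lia.
    have -> : (j = K + (j - K))%N by lia.
    rewrite self_glue_bottom //; [|lia|lia].
    rewrite -dualE; [|lia|lia]; congr (H _ _); lia.
  + have -> : (2 * K - K = K)%N by lia.
    rewrite self_glue_row //; last by lia.
    have -> : (k = K + (k - K))%N by lia.
    rewrite self_glue_col //; last by lia.
    rewrite -row_col; last by lia.
    by have -> : (2 * K - (K + (k - K)) = K - (k - K))%N by lia.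
- subst k; have [jK|Kj|->] := ltngtP j K; [|lia|].
  + have -> : (2 * K - j = K + (K - j))%N by lia.
    have -> : (2 * K - K = K)%N by lia.
    rewrite self_glue_row ?self_glue_col //; [|lia|lia].
    rewrite -row_col; last by lia.
    by have -> : (K - (K - j) = j)%N by lia.
  + by have -> : (2 * K - K = K)%N by lia.
Qed.

End Glue.

(** * The FSDM matrices and the final rate *)

Lemma self_glue_diag (R : realType) (K : nat) (H : nat -> nat -> R) :
  (0 < K)%N -> (forall i, (0 < i < K)%N -> H i i != 0) ->
  forall i, (0 < i < 2 * K)%N -> self_glue R K H i i != 0.
Proof.
move=> K_gt0 H0 i iK; have [iltK|Klti|->] := ltngtP i K.
- rewrite self_glue_top ?H0 //; lia.
- have -> : (i = K + (i - K))%N by lia.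
  rewrite self_glue_bottom ?H0 //; lia.
- by rewrite self_glue_mid // mulf_neq0 ?invr_eq0 // pnatr_eq0; lia.
Qed.

(** The first three properties at stage [n] yield the fourth, and through it they pass to stage
    [n + 1]; hence one joint induction. *)
Lemma H_FSDM_self_glue (R : realType) (n : nat) :
  [/\ Hdual (2 ^ n) (H_FSDM R n) = H_FSDM R n,
      forall i, (0 < i < 2 ^ n)%N -> H_FSDM R n i i != 0,
      averaging R (2 ^ n) (H_FSDM R n) &
      H_FSDM R n.+1 = self_glue R (2 ^ n) (H_FSDM R n)].
Proof.
have step m : Hdual (2 ^ m) (H_FSDM R m) = H_FSDM R m ->
    (forall i, (0 < i < 2 ^ m)%N -> H_FSDM R m i i != 0) ->
    averaging R (2 ^ m) (H_FSDM R m) ->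
    H_FSDM R m.+1 = self_glue R (2 ^ m) (H_FSDM R m).
  move=> selfdual diag avg.
  by rewrite [LHS]/= selfdual expnS glue_selfdual // expn_gt0.
elim: n => [|n [selfdual diag avg eqD]].
  have selfdual0 : Hdual (2 ^ 0) (H_FSDM R 0) = H_FSDM R 0.
    by apply/funext => k; apply/funext => j; rewrite /Hdual; case: ifP.
  have diag0 i : (0 < i < 2 ^ 0)%N -> H_FSDM R 0 i i != 0 by case: i.
  have avg0 : averaging R (2 ^ 0) (H_FSDM R 0).
    by move=> A _; rewrite scale1r expr1 addrC addKr.
  by split=> //; apply: step.
have K_gt0 : (0 < 2 ^ n)%N by rewrite expn_gt0.
have selfdual' : Hdual (2 ^ n.+1) (H_FSDM R n.+1) = H_FSDM R n.+1.
  by rewrite eqD expnS Hdual_self_glue.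
have diag' i : (0 < i < 2 ^ n.+1)%N -> H_FSDM R n.+1 i i != 0.
  by rewrite eqD expnS; apply: self_glue_diag.
have avg' : averaging R (2 ^ n.+1) (H_FSDM R n.+1).
  by rewrite eqD expnS; apply: averaging_self_glue.
by split=> //; apply: step.
Qed.

Lemma rate_bound_FSDM (R : realType) (X : lmodType R)
    (dot : {dot X for idfun}) (n : nat) :
  rate_bound R X dot (2 ^ n) (H_FSDM R n).
Proof.
elim: n => [|n IH].
  by move=> y u _ _; rewrite !subrr mul0r linear0l mulr0 addr0.
have [_ _ _ ->] := H_FSDM_self_glue R n.
by rewrite expnS; apply: rate_bound_self_glue; rewrite ?expn_gt0.
Qed.

(* X with dot is an arbitrary real Hilbert space. *)
Theorem proposition6 (R : realType) (X : completeNormedModType R)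
    (dot : {dot X for idfun}) (dot_norm : forall x : X, dot x x = `|x| ^+ 2)
    (T : X -> X) (T_nonexpansive : nonexpansive T)
    (ystar : X) (ystar_fixed : T ystar = ystar)
    (y0 : X) (y : nat -> X) (y_start : y 0%N = y0) (y_FSDM : FSDM T y)
    (n : nat) (n_ge1 : (1 <= n)%N) :
  `|y (2 ^ n - 1)%N - T (y (2 ^ n - 1)%N)| ^+ 2
    <= 4 * `|y0 - ystar| ^+ 2 / 2 ^+ (2 * n).
Proof.
have dZl a x z : dot (a *: x) z = a * dot x z by exact: linearZl_LR.
have dZr a x z : dot x (a *: z) = a * dot x z by exact: linearZr_LR.
have dBl x x' z : dot (x - x') z = dot x z - dot x' z by exact: linearBl.
have dBr x z z' : dot x (z - z') = dot x z - dot x z' by exact: linearBr.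
have mono x z : dot ((x - T x) - (z - T z)) ((x - T x) - (z - T z))
    <= 2 * dot (x - z) ((x - T x) - (z - T z)).
  have : dot (T x - T z) (T x - T z) <= dot (x - z) (x - z).
    by rewrite !dot_norm lerXn2r ?nnegrE ?normr_ge0.
  have -> : T x - T z = (x - z) - ((x - T x) - (z - T z)).
    by rewrite !opprB (addrC (z - _)) addrACA addKr (addrC x) subrK.
  move: (x - z) ((x - T x) - (z - T z)) => d e.
  rewrite !(dBl, dBr) (dotC R X dot e d); lra.
have main := rate_bound_FSDM R X dot n y (fun k => y k - T (y k))
  (y_FSDM n n_ge1) (fun i j _ _ => mono (y i) (y j)).
(* The increment at the fixed point is zero, so this bounds [|u|^2] by [2 <Y - ystar, u>]. *)
have := mono (y (2 ^ n - 1)%N) ystar.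
move: main; rewrite ystar_fixed subrr subr0 y_start -!dot_norm natrX mulnC exprM.
set u := y _ - T _; move: u => u; move: (y (2 ^ n - 1)%N) => Y.
have : 0 < 2 ^+ n :> R by rewrite exprn_gt0.
move: (2 ^+ n) => K K_gt0 main last.
rewrite ler_pdivlMr ?exprn_gt0 //.
(* With [d = y0 - ystar], adding [main] and [last] gives [K |u|^2 <= 2 <u, d>]; expanding
   [|K u - 2 d|^2 >= 0] then gives [K^2 |u|^2 <= 4 |d|^2]. *)
move: main last (dot_norm (K *: u - 2 *: (y0 - ystar))).
have -> : Y - y0 = (Y - ystar) - (y0 - ystar) by rewrite opprB addrA subrK.
move: (Y - ystar) (y0 - ystar) => a d.
rewrite !(dBl, dBr, dZl, dZr) (dotC R X dot d u) => main last sq.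
have := sqr_ge0 `|K *: u - 2 *: d|; rewrite -sq.
have : K * (K * dot u u) <= K * (2 * dot u d).
  by rewrite ler_pM2l //; lra.
by rewrite expr2; lra.
Qed.
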